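(* For every integer $d\ge 2$, there is an infinite number of lattices $\Lambda \subset \mathbb{Z}^d$ such that there is a toric polyomino in $\mathbb{R}^d/\Lambda$ with exactly $\frac{d}{2d-1}\det(\Lambda)$ tiles and exactly $\frac{d-1}{2d-1}\det(\Lambda)$ holes.
   Context: A lattice $\Lambda\subset\mathbb{Z}^d$ is a subgroup of rank $d$; $\det(\Lambda)$ is its covolume, i.e. the volume of $\mathbb{R}^d/\Lambda$. The tessellation of $\mathbb{R}^d$ by closed unit cubes (integer translates of one axis-parallel unit cube) is invariant under $\Lambda$, so it descends to a tessellation of the torus $\mathbb{R}^d/\Lambda$ by $\det(\Lambda)$ unit cubes (tiles). Two tiles are adjacent if they share a $(d-1)$-dimensional face (i.e. they have lifts to $\mathbb{R}^d$ sharing a $(d-1)$-dimensional face). A toric polyomino in $\mathbb{R}^d/\Lambda$ is a union of such tiles that is rook-connected: any two of its tiles are joined by a sequence of its tiles in which consecutive tiles are adjacent. A hole in a toric polyomino is a connected component of its complement in $\mathbb{R}^d/\Lambda$. *)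

(* Defs.v *)
From HB Require Import structures.
From mathcomp Require Import all_boot all_order all_algebra.
From mathcomp Require Import generic_quotient.
From mathcomp Require Import boolp classical_sets functions cardinality reals.
From mathcomp Require Import topology normedtype.

Set Implicit Arguments.
Unset Strict Implicit.
Unset Printing Implicit Defensive.

Import Order.TTheory GRing.Theory Num.Theory.
Import numFieldNormedType.Exports.

Local Open Scope classical_set_scope.
Local Open Scope ring_scope.

Definition independent_rows (d : nat) (B : 'M[int]_d) : bool :=
  row_free (map_mx intr B : 'M[rat]_d).

Record lattice (d : nat) := Lattice {
  lattice_set :> set 'rV[int]_d ;
  lattice0 : lattice_set 0 ;
  latticeB : forall u v, lattice_set u -> lattice_set v -> lattice_set (u - v) ;
  lattice_rank : exists B : 'M[int]_d,
    independent_rows B /\ forall i, lattice_set (row i B)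
}.

(* Distinct records are distinct subgroups, so counting elements of
   [lattice d] is counting lattices. *)
Lemma lattice_inj (d : nat) : injective (@lattice_set d).
Proof.
move=> [L L0 LB Lr] [M M0 MB Mr] /= eLM; subst M.
by congr Lattice; exact: Prop_irrelevance.
Qed.

Definition lattice_basis (d : nat) (L : lattice d) (B : 'M[int]_d) : Prop :=
  independent_rows B /\ lattice_set L = range (fun c : 'rV[int]_d => c *m B).

(* The volume of the fundamental parallelepiped spanned by a basis; it is the
   same for all bases, see [covolumeE]. *)
Definition covolume (d : nat) (L : lattice d) : nat :=
  xget 0%N [set n | exists2 B, lattice_basis L B & n = `|\det B|%N].

Lemma covolumeE (d : nat) (L : lattice d) (B : 'M[int]_d) :
  lattice_basis L B -> covolume L = `|\det B|%N.
Proof.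
have key (A C : 'M[int]_d) : lattice_basis L A -> lattice_basis L C ->
    (`|\det A| %| `|\det C|)%N.
  move=> [_ LA] [_ LC].
  have /boolp.choice [f fE] (i : 'I_d) : exists c : 'rV[int]_d, c *m A = row i C.
    have : lattice_set L (row i C) by rewrite LC; exists (delta_mx 0 i); rewrite // -rowE.
    by rewrite LA => -[c _ <-]; exists c.
  have -> : C = (\matrix_i f i) *m A.
    by apply/row_matrixP => i; rewrite row_mul rowK fE.
  by rewrite det_mulmx abszM dvdn_mull.
move=> LB; rewrite /covolume; case: xgetP => [n _ [C LC ->]|/(_ `|\det B|%N)].
  by apply/eqP; rewrite eqn_dvd !key.
by case; exists B.
Qed.

Section Torus.
Variables (R : realType) (d : nat) (L : lattice d).

Definition congr_lattice (x y : 'rV[R]_d) : bool :=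
  `[< exists2 v, lattice_set L v & x - y = map_mx intr v >].

Lemma congr_lattice_refl : reflexive congr_lattice.
Proof.
move=> x; apply/asboolP; exists 0; first exact: lattice0.
by rewrite subrr map_mx0.
Qed.

Lemma congr_lattice_subr (x y z : 'rV[R]_d) :
  congr_lattice x z -> congr_lattice y z -> congr_lattice x y.
Proof.
move=> /asboolP[u Lu uE] /asboolP[v Lv vE]; apply/asboolP.
exists (u - v); first exact: latticeB.
by rewrite map_mxB -uE -vE opprB addrA subrK.
Qed.

Lemma congr_lattice_sym : symmetric congr_lattice.
Proof.
by move=> x y; apply/idP/idP; exact: congr_lattice_subr (congr_lattice_refl _).
Qed.

Lemma congr_lattice_trans : transitive congr_lattice.
Proof.
move=> y x z xy yz; apply: congr_lattice_subr xy _.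
by rewrite congr_lattice_sym.
Qed.

Canonical congr_lattice_equiv :=
  EquivRel congr_lattice congr_lattice_refl congr_lattice_sym
    congr_lattice_trans.

Definition torus : Type := quotient_topology {eq_quot congr_lattice}%qT.
HB.instance Definition _ := Topological.on torus.
HB.instance Definition _ := Quotient.on torus.

Definition torus_proj (x : 'rV[R]_d) : torus := \pi_torus%qT x.

Definition cube (n : 'rV[int]_d) : set 'rV[R]_d :=
  [set x | forall j, (n 0 j)%:~R <= x 0 j <= (n 0 j + 1)%:~R].

(* The facet of [cube n] orthogonal to the i-th axis, at the lower (b = false)
   or the upper (b = true) end. *)
Definition facet (n : 'rV[int]_d) (i : 'I_d) (b : bool) : set 'rV[R]_d :=
  [set x | cube n x /\ x 0 i = (n 0 i + b%:Z)%:~R].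

Definition share_facet (m n : 'rV[int]_d) : Prop :=
  m <> n /\ exists i b j c, facet m i b = facet n j c.

Definition tile (n : 'rV[int]_d) : set torus := torus_proj @` cube n.

Definition tiles : set (set torus) := range tile.

Definition adjacent (A B : set torus) : Prop :=
  exists m n, [/\ A = tile m, B = tile n & share_facet m n].

Definition rook_connected (S : set (set torus)) : Prop :=
  forall A B, S A -> S B ->
    exists (k : nat) (s : nat -> set torus),
      [/\ s 0%N = A, s k = B,
          forall i, (i <= k)%N -> S (s i) &
          forall i, (i < k)%N -> adjacent (s i) (s i.+1)].

Definition toric_polyomino (S : set (set torus)) (P : set torus) : Prop :=
  [/\ S `<=` tiles, rook_connected S & P = \bigcup_(A in S) A].

Definition holes (P : set torus) : set (set torus) :=
  [set connected_component (~` P) x | x in ~` P].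

End Torus.

(* Main.v *)
Require Import Defs.
From mathcomp Require Import all_boot all_order all_algebra.
From mathcomp Require Import generic_quotient zify ring.
From mathcomp Require Import boolp classical_sets functions cardinality reals.
From mathcomp Require Import topology normedtype.

Set Implicit Arguments.
Unset Strict Implicit.
Unset Printing Implicit Defensive.

Import Order.TTheory GRing.Theory Num.Theory.
Import numFieldNormedType.Exports.
Local Open Scope classical_set_scope.
Local Open Scope card_scope.
Local Open Scope ring_scope.

(** For an even [N], weigh the cell [n] of Z^d by [sum_j (2j+1) n_j], with j
    running from 0 to d-1, and let the lattice consist of the cells of weight
    divisible by [N]; its covolume is [N], and the tiles of the torus are the
    residues modulo [N].  Neighbouring tiles have weights that differ by
    an odd number among 1, 3, ..., 2d-1.

    Let [M = 2(2d-1)] and let [N] be a multiple of [M].  The polyomino keeps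
    the tiles whose weight is odd or divisible by [M].  In each period there are
    [(2d-1) + 1 = 2d] kept residues out of [M] and [2d-2] removed ones, which
    gives the two ratios.  Different multiples of [M] give lattices of different
    covolumes, hence infinitely many of them.

    The kept tiles are rook-connected ([kept_rook_connected]).  The distance from
    an odd weight to the nearest multiple of [M] is an odd number at most
    [M/2 = 2d-1], hence one of the d steps; so every odd tile touches a tile whose
    weight is a multiple of [M], and the tile of weight [qM + (2d-1)] touches both
    that of weight [qM] and that of weight [(q+1)M].

    The removed tiles have even weight, so no two of them share a facet.  Then
    every removed cell is a hole by itself ([holes_isolated]): a point with an
    integral coordinate lies in two closed cubes sharing a facet, one of which is
    kept, so that the complement of the polyomino is the disjoint union of
    the open removed cubes, each of them open and connected. *)

(** * Closed and open tiles of a torus *)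

Section Tiles.
Variables (R : realType) (d : nat) (L : lattice d).
Implicit Types (m n v : 'rV[int]_d) (x y : 'rV[R]_d).

Local Notation proj := (@torus_proj R d L).
Local Notation tile := (@tile R d L).
Local Notation real_row v := (map_mx intr v : 'rV[R]_d).

Lemma torus_projP x y :
  proj x = proj y <-> exists2 v, lattice_set L v & x - y = real_row v.
Proof. by split=> [/eqmodP/asboolP|?]//; apply/eqmodP/asboolP. Qed.

Lemma latticeN v : lattice_set L v -> lattice_set L (- v).
Proof. by move=> Lv; rewrite -sub0r; apply: latticeB => //; exact: lattice0. Qed.

Definition open_cube n : set 'rV[R]_d :=
  [set x | forall j, (n 0 j)%:~R < x 0 j < (n 0 j + 1)%:~R].

Definition open_tile n : set (torus R L) := proj @` open_cube n.

Lemma open_cube_sub n : open_cube n `<=` @cube R d n.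
Proof. by move=> x nx j; have /andP[/ltW -> /ltW ->] := nx j. Qed.

Lemma cube_translate n v x : @cube R d n x -> cube (n + v) (x + real_row v).
Proof.
by move=> nx j; move: (nx j); rewrite !mxE addrAC ![(_ + v 0 j)%:~R]intrD !lerD2r.
Qed.

Lemma open_cube_translate n v x : open_cube n x -> open_cube (n + v) (x + real_row v).
Proof.
by move=> nx j; move: (nx j); rewrite !mxE addrAC ![(_ + v 0 j)%:~R]intrD !ltrD2r.
Qed.

Lemma open_cube_cube m n x : open_cube n x -> cube m x -> m = n.
Proof.
move=> nx mx; apply/rowP => j; have /andP[n1 n2] := nx j; have /andP[m1 m2] := mx j.
have := le_lt_trans m1 n2; have := lt_le_trans n1 m2.
by rewrite !ltr_int => ? ?; lia.
Qed.

Lemma open_cube_nonempty n : exists x, open_cube n x.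
Proof.
exists (\row_j ((n 0 j)%:~R + 2^-1)) => j; rewrite mxE intrD ltrDl ltrD2l.
by rewrite invr_gt0 ltr0n invf_lt1 ?ltr1n// ltr0n.
Qed.

Lemma proj_translate v x : lattice_set L v -> proj (x + real_row v) = proj x.
Proof. by move=> Lv; apply/torus_projP; exists v => //; rewrite addrC addKr. Qed.

Lemma tile_open_cube m n x : open_cube n x -> tile m (proj x) -> lattice_set L (m - n).
Proof.
move=> nx [y my /torus_projP[v Lv yx]].
have /open_cube_cube := open_cube_translate v nx.
by rewrite -yx addrC subrK => /(_ m my) ->; rewrite addrC addKr.
Qed.

Lemma tile_eq m n : tile m = tile n <-> lattice_set L (m - n).
Proof.
have sub a b : lattice_set L (a - b) -> tile a `<=` tile b.
  move=> Lab _ [x ax <-]; rewrite -(proj_translate _ (latticeN Lab)).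
  exists (x + real_row (- (a - b))) => //.
  by have := cube_translate (- (a - b)) ax; rewrite opprB addrC subrK.
split=> [mn|Lmn]; last first.
  by apply/seteqP; split; apply: sub => //; rewrite -opprB; exact: latticeN.
have [x nx] := open_cube_nonempty n; apply: (tile_open_cube nx).
by rewrite mn; exists x => //; exact: open_cube_sub.
Qed.

Lemma open_tile_meet m n z : open_tile m z -> open_tile n z -> lattice_set L (m - n).
Proof.
move=> [x mx <-] [y ny yx]; apply: (tile_open_cube ny).
by rewrite yx; exists x => //; exact: open_cube_sub.
Qed.

Lemma open_tile_eq m n : open_tile m = open_tile n <-> lattice_set L (m - n).
Proof.
have sub a b : lattice_set L (a - b) -> open_tile a `<=` open_tile b.
  move=> Lab _ [x ax <-]; rewrite -(proj_translate _ (latticeN Lab)).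
  exists (x + real_row (- (a - b))) => //.
  by have := open_cube_translate (- (a - b)) ax; rewrite opprB addrC subrK.
split=> [mn|Lmn]; last first.
  by apply/seteqP; split; apply: sub => //; rewrite -opprB; exact: latticeN.
have [x mx] := open_cube_nonempty m; apply: (@open_tile_meet m n (proj x)).
  by exists x.
by rewrite -mn; exists x.
Qed.

Lemma open_cube_open n : open (open_cube n).
Proof.
rewrite openE => x nx.
exists (fun i j => [set r : R | (n 0 j)%:~R < r < (n 0 j + 1)%:~R]) => [i j|y ny j].
  have := nx j; rewrite ord1 => nxj; apply: open_nbhs_nbhs; split => //.
  have -> : [set r : R | (n 0 j)%:~R < r < (n 0 j + 1)%:~R] =
      [set` `](n 0 j)%:~R, (n 0 j + 1)%:~R[].
    by apply/seteqP; split => r /=; rewrite in_itv.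
  exact: interval_open.
exact: ny.
Qed.

(** The preimage of an open tile is a union of translates of an open cube. *)
Lemma open_tile_open n : open (open_tile n).
Proof.
rewrite /open /= /quotient_open.
have -> : \pi_(torus R L)%qT @^-1` open_tile n =
    \bigcup_(v in lattice_set L) open_cube (n + v).
  apply/seteqP; split=> [x [y ny /esym/torus_projP[v Lv xy]]|x [v Lv nx]].
    by exists v => //; move: (open_cube_translate v ny); rewrite -xy [y + _]addrC subrK.
  suff -> : open_tile n = open_tile (n + v) by exists x.
  by apply/open_tile_eq; rewrite opprD addrA subrr sub0r; exact: latticeN.
by apply: bigcup_open => v _; exact: open_cube_open.
Qed.

(** An open cube is the union of the segments from a fixed point of it, by
    convexity. *)
Lemma open_cube_connected n : connected (open_cube n).
Proof.
have [c nc] := open_cube_nonempty n.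
pose seg x := (fun t : R => c + t *: (x - c)) @` `[0, 1].
have segE : open_cube n = \bigcup_(x in open_cube n) seg x.
  apply/seteqP; split=> [x nx|y [x nx [t /=]]].
    exists x => //; exists 1; rewrite /= ?scale1r 1?addrC ?subrK//.
    by rewrite in_itv/= ler01 lexx.
  rewrite in_itv/= => /andP[t0 t1] <- j; rewrite !mxE.
  have /andP[c1 c2] := nc j; have /andP[x1 x2] := nx j.
  have -> : c 0 j + t * (x 0 j - c 0 j) = (1 - t) * c 0 j + t * x 0 j.
    by rewrite mulrBr mulrBl mul1r addrA addrAC.
  move: t1; rewrite le_eqVlt => /predU1P[->|t1].
    by rewrite subrr mul0r add0r mul1r x1 x2.
  have s0 : 0 < 1 - t by rewrite subr_gt0.
  have E a : a = (1 - t) * a + t * a by rewrite -mulrDl subrK mul1r.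
  rewrite [ltLHS]E [X in _ && (_ < X)]E.
  by rewrite !ltr_leD ?ltr_pM2l// ler_wpM2l// ltW.
rewrite segE; apply: bigcup_connected.
  by exists c => x _; exists 0; rewrite /= ?in_itv/= ?ler01 ?lexx// scale0r addr0.
move=> x _; apply: connected_continuous_connected.
  by apply/connected_intervalP; exact: interval_is_interval.
apply: continuous_subspaceT => t.
apply: cvgD; first exact: cvg_cst.
by apply: cvgZr_tmp; exact: cvg_id.
Qed.

Lemma open_tile_connected n : connected (open_tile n).
Proof.
apply: connected_continuous_connected; first exact: open_cube_connected.
by apply: continuous_subspaceT; exact: pi_continuous.
Qed.


Lemma cube_face_neighbour n j x :
  @cube R d n x -> x 0 j = (n 0 j)%:~R -> cube (n - delta_mx 0 j) x.
Proof.
move=> nx xj i; rewrite !mxE eqxx/=; have [->|_] := eqVneq i j; last by rewrite subr0.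
by rewrite xj subrK lexx ler_int gerBl.
Qed.

Lemma adjacent_delta n j : @adjacent R d L (tile n) (tile (n + delta_mx 0 j)).
Proof.
exists n, (n + delta_mx 0 j); split=> //; split=> [/rowP/(_ j)|].
  by rewrite !mxE !eqxx => /eqP; rewrite -subr_eq0 opprD addrA subrr sub0r oppr_eq0.
exists j, true, j, false; apply/seteqP; split=> x [nx xj]; split.
- move=> i; rewrite !mxE eqxx/=; have [->|_] := eqVneq i j.
    by rewrite xj lexx ler_int lerDl.
  by rewrite addr0; exact: nx.
- by rewrite xj !mxE !eqxx addr0.
- rewrite -[n](addrK (delta_mx 0 j)); apply: cube_face_neighbour => //.
  by rewrite xj addr0.
- by rewrite xj !mxE !eqxx addr0.
Qed.

Lemma adjacent_sym A B : @adjacent R d L A B -> adjacent B A.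
Proof.
move=> [m [n [-> -> [mn [i [b [j [c mnE]]]]]]]]; exists n, m; split=> //.
by split; [move=> nm; exact: mn | exists j, c, i, b].
Qed.

(** If no two cells sharing a facet are both removed, nothing of a cube's boundary
    is left in the complement, so distinct removed cells are disconnected. *)
Lemma holes_isolated (K : set 'rV[int]_d) :
  (forall m n, lattice_set L (m - n) -> K m -> K n) ->
  (forall n j, K n \/ K (n + delta_mx 0 j)) ->
  holes (\bigcup_(A in tile @` K) A) = open_tile @` ~` K.
Proof.
move=> KL Kadj; set P := \bigcup_(A in _) A.
have compl_open_tile z : (~` P) z -> exists2 n, ~ K n & open_tile n z.
  rewrite -[z]reprK; set x := repr z => Px.
  pose n : 'rV[int]_d := \row_j Num.floor (x 0 j).
  have nx : cube n x.
    by move=> j; rewrite mxE; have /andP[-> /ltW ->] := floor_itv (x 0 j).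
  have inP m : K m -> cube m x -> False.
    by move=> Km mx; apply: Px; exists (tile m); [exists m|exists x].
  have nK : ~ K n by move=> Kn; exact: (inP n).
  exists n => //; exists x => // j; rewrite mxE.
  (* An integral coordinate would put x in the cell below n as well. *)
  have /andP[nj ->] := floor_itv (x 0 j); rewrite andbT lt_neqAle nj andbT.
  apply/negP => /eqP xj; have [] := Kadj (n - delta_mx 0 j) j; last by rewrite subrK.
  by move=> Kn'; apply: (inP _ Kn'); apply: cube_face_neighbour; rewrite ?mxE.
have open_tile_compl n : ~ K n -> open_tile n `<=` ~` P.
  move=> nK _ [x nx <-] [_ [m Km <-] mx]; apply: nK.
  by apply: KL Km; exact: tile_open_cube nx mx.
suff comp n z : ~ K n -> open_tile n z -> connected_component (~` P) z = open_tile n.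
  apply/seteqP; split=> [_ [z Pz <-]|_ [n nK <-]].
    by have [n nK nz] := compl_open_tile z Pz; exists n => //; rewrite (comp n).
  have [x nx] := open_cube_nonempty n.
  exists (proj x); first by apply: (open_tile_compl n nK); exists x.
  by apply: comp => //; exists x.
move=> nK nz; apply/seteqP; split; last first.
  apply: connected_component_max => //; first exact: open_tile_compl.
  exact: open_tile_connected.
(* The other removed open tiles form an open set, so this one is clopen in the
   complement. *)
pose C := connected_component (~` P) z.
pose U := \bigcup_(m in [set m | ~ K m /\ ~ lattice_set L (m - n)]) open_tile m.
have CE : C `&` open_tile n = C.
  apply: (@component_connected _ (~` P) z).
  - by exists z; split=> //; exact/connected_component_refl/(open_tile_compl n).
  - by exists (open_tile n) => //; exact: open_tile_open.
  - exists (~` U).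
      by apply: open_closedC; apply: bigcup_open => m _; exact: open_tile_open.
    apply/seteqP; split=> y [Cy]; last first.
      move=> Uy; split=> //.
      have [m mK my] := compl_open_tile y (connected_component_sub Cy).
      have [Lmn|Lmn] := pselect (lattice_set L (m - n)).
        by rewrite -((open_tile_eq m n).2 Lmn).
      by exfalso; apply: Uy; exists m.
    by move=> ny; split=> // -[m [_ Lmn] my]; apply: Lmn; exact: open_tile_meet ny.
by rewrite -/C -CE => y [].
Qed.

End Tiles.

(** * Joining tiles by rook paths *)

Section RookPaths.
Variables (R : realType) (d : nat) (L : lattice d) (S : set (set (torus R L))).
Implicit Types A B C : set (torus R L).

Definition rook_joined A B := exists (k : nat) (s : nat -> set (torus R L)),
  [/\ s 0%N = A, s k = B, forall i, (i <= k)%N -> S (s i) &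
      forall i, (i < k)%N -> adjacent (s i) (s i.+1)].

Lemma rook_joined_refl A : S A -> rook_joined A A.
Proof. by move=> SA; exists 0%N, (fun=> A). Qed.

Lemma rook_joined_sym A B : rook_joined A B -> rook_joined B A.
Proof.
move=> [k [s [s0 sk Ss adj]]]; exists k, (fun i => s (k - i)%N).
split=> [| |i ik|i ik]; rewrite ?subn0 ?subnn//; first by apply: Ss; lia.
apply: adjacent_sym; have -> : (k - i = (k - i.+1).+1)%N by lia.
by apply: adj; lia.
Qed.

Lemma rook_joined_trans B A C : rook_joined A B -> rook_joined B C -> rook_joined A C.
Proof.
move=> [k [s [s0 sk Ss adj]]] [l [t [t0 tl St adjt]]].
exists (k + l)%N, (fun i => if (i <= k)%N then s i else t (i - k)%N); split=> //.
- case: leqP => [|_]; last by rewrite addKn.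
  by move=> lk; have l0 : l = 0%N by [lia]; rewrite l0 addn0 sk -t0 -tl l0.
- by move=> i ikl; case: leqP => ik; [exact: Ss | apply: St; lia].
move=> i ikl; case: leqP => ik; case: leqP => ik1; try lia.
- have -> : i = k by lia.
  by rewrite sk -t0 subSnn; apply: adjt; lia.
- by rewrite subSn ?(ltnW ik)//; apply: adjt; lia.
- exact: adj.
Qed.

Lemma rook_joined_adjacent A B : S A -> S B -> adjacent A B -> rook_joined A B.
Proof.
move=> SA SB AB; exists 1%N, (fun i => if i is 0 then A else B).
by split=> // -[].
Qed.

Lemma rook_connected_from A : (forall B, S B -> rook_joined B A) -> rook_connected S.
Proof.
by move=> SA B C /SA BA /SA /rook_joined_sym; exact: rook_joined_trans.
Qed.

End RookPaths.

(** * Counting and divisibility *)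

Lemma dvdz_addr (c a b : int) : (c %| a)%Z -> (c %| a + b)%Z = (c %| b)%Z.
Proof. exact: rpredDl. Qed.

Lemma card_uniq_seq (T : eqType) (x0 : T) (s : seq T) :
  uniq s -> [set` s] #= `I_(size s).
Proof.
move=> us; have <- : nth x0 s @` `I_(size s) = [set` s].
  apply/seteqP; split=> [_ [i si <-]|x /= /(nthP x0)[i si <-]]; first exact: mem_nth.
  by exists i.
apply: inj_card_eq => i j /set_mem si /set_mem sj /eqP.
by rewrite nth_uniq// => /eqP.
Qed.

Lemma count_iota_periodic (p : pred nat) (n k : nat) :
  (forall r, p (r + n)%N = p r) ->
  count p (iota 0 (k * n)) = (k * count p (iota 0 n))%N.
Proof.
move=> pn; elim: k => [|k IH]; first by rewrite !mul0n.
rewrite !mulSn iotaD add0n count_cat -IH; congr addn.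
rewrite -[X in iota X]addn0 iotaDl count_map.
by apply: eq_count => r /=; rewrite addnC pn.
Qed.

(** * The lattice of cells of weight divisible by N *)

Section WeightLattice.
Variables (d N : nat) (N0 : (0 < N)%N).
Implicit Types (m n : 'rV[int]_d.+1) (a b : int).

Definition weight n : int := (n *m \col_(j < d.+1) (j.*2.+1)%:Z) 0 0.

Lemma weightD m n : weight (m + n) = weight m + weight n.
Proof. by rewrite /weight mulmxDl mxE. Qed.

Lemma weightB m n : weight (m - n) = weight m - weight n.
Proof. by rewrite /weight mulmxBl !mxE. Qed.

Lemma weight_delta a j : weight (a *: delta_mx 0 j) = a * (j.*2.+1)%:Z.
Proof. by rewrite /weight -scalemxAl -rowE !mxE. Qed.

(** The row of index i > 0 is [e_i - (2i+1) e_0], of weight 0, and the first one is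
    [N e_0], of weight [N]. *)
Definition weight_basis : 'M[int]_d.+1 :=
  \matrix_(i, j) if j == 0 then if i == 0 then N%:Z else - (i.*2.+1)%:Z
                 else (i == j)%:Z.

Lemma det_weight_basis : \det weight_basis = N%:Z.
Proof.
rewrite det_trig; last first.
  apply/is_trig_mxP => i j ij; rewrite mxE.
  have -> : (j == 0) = false by apply/eqP => j0; rewrite j0 in ij.
  by have -> : (i == j) = false by apply/eqP => ij'; rewrite ij' ltnn in ij.
by rewrite big_ord_recl mxE /= big1 ?mulr1// => i _; rewrite mxE eqxx.
Qed.

Lemma weight_basis_independent : independent_rows weight_basis.
Proof.
rewrite /independent_rows row_free_unit unitmxE det_map_mx det_weight_basis.
by rewrite unitfE intr_eq0 -lt0n.
Qed.

Lemma range_weight_basis :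
  range (fun c : 'rV[int]_d.+1 => c *m weight_basis) = [set n | (N %| weight n)%Z].
Proof.
have coord0 (c : 'rV[int]_d.+1) : (c *m weight_basis) 0 0 =
    c 0 0 * N%:Z - \sum_(i < d) c 0 (lift ord0 i) * ((lift ord0 i).*2.+1)%:Z.
  rewrite mxE big_ord_recl mxE /= -sumrN; congr (_ + _); apply: eq_bigr => i _.
  by rewrite mxE /= mulrN.
have coordS (c : 'rV[int]_d.+1) j :
    (c *m weight_basis) 0 (lift ord0 j) = c 0 (lift ord0 j).
  rewrite mxE (bigD1 (lift ord0 j))//= mxE /= eqxx mulr1 big1 ?addr0// => i ij.
  by rewrite mxE /= (negPf ij) mulr0.
have weightE n : weight n =
    n 0 0 + \sum_(i < d) n 0 (lift ord0 i) * ((lift ord0 i).*2.+1)%:Z.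
  rewrite /weight mxE big_ord_recl mxE mulr1; congr (_ + _).
  by apply: eq_bigr => i _; rewrite mxE.
apply/seteqP; split=> [_ [c _ <-]|n /= /dvdzP[q qN]].
  rewrite /= weightE; under eq_bigr do rewrite coordS.
  by rewrite coord0 subrK dvdz_mull.
(* Apart from column 0, the basis is the identity matrix, which forces c. *)
pose c : 'rV[int]_d.+1 := \row_i if i == 0 then q else n 0 i.
exists c => //; apply/rowP => j; case: (unliftP ord0 j) => [i|] ->.
  by rewrite coordS mxE.
rewrite coord0 mxE /= -qN weightE; under [X in _ - X]eq_bigr do rewrite mxE /=.
by rewrite addrK.
Qed.

Definition weight_lattice : lattice d.+1.
Proof.
refine (@Lattice d.+1 [set n | (N %| weight n)%Z] _ _ _).
- by rewrite /= /weight mul0mx mxE dvdz0.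
- by move=> u v /= uN vN; rewrite weightB rpredB.
exists weight_basis; split; first exact: weight_basis_independent.
by move=> i; rewrite -range_weight_basis; exists (delta_mx 0 i); rewrite // -rowE.
Defined.

Lemma covolume_weight_lattice : covolume weight_lattice = N.
Proof.
rewrite (@covolumeE _ _ weight_basis) ?det_weight_basis//.
by split; [exact: weight_basis_independent | rewrite range_weight_basis].
Qed.

Lemma weight_latticeP m n :
  lattice_set weight_lattice (m - n) <-> (N %| weight m - weight n)%Z.
Proof. by rewrite -weightB. Qed.

(** Weights modulo [N] classify the tiles, open or closed, since every residue is
    the weight of a multiple of [e_0]; so tiles can be counted by residue. *)
Lemma card_weight_classes (X : Type) (F : 'rV[int]_d.+1 -> X) (q : int -> bool) :
  (forall m n, F m = F n <-> lattice_set weight_lattice (m - n)) ->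
  (forall a b, (N %| a - b)%Z -> q a = q b) ->
  F @` [set n | q (weight n)] #= `I_(count (fun r : nat => q r%:Z) (iota 0 N)).
Proof.
move=> FE qN; set s := [seq r <- iota 0 N | q r%:Z].
pose G r := F (r%:Z *: delta_mx 0 0).
have wG r : weight (r%:Z *: delta_mx 0 0) = r%:Z by rewrite weight_delta mulr1.
have -> : F @` [set n | q (weight n)] = G @` [set` s].
  apply/seteqP; split=> [_ [n qn <-]|_ [r + <-]]; last first.
    rewrite /= mem_filter => /andP[qr _].
    by exists (r%:Z *: delta_mx 0 0); rewrite //= wG.
  have [r rE] : exists r : nat, (weight n %% N)%Z = r%:Z.
    by exists `|(weight n %% N)%Z|%N; rewrite gez0_abs// modz_ge0// -lt0n.
  have rn : (N %| r%:Z - weight n)%Z.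
    by rewrite -rE -eqz_mod_dvd modz_mod.
  exists r; last by apply/FE/weight_latticeP; rewrite wG.
  rewrite /= mem_filter (qN _ _ rn); apply/andP; split; first exact: qn.
  by rewrite mem_iota /= add0n -ltz_nat -rE ltz_pmod.
have sN r : r \in [set` s] -> (r < N)%N.
  by move=> /set_mem; rewrite /= mem_filter mem_iota => /andP[_ /andP[_]].
apply: card_eq_trans.
  apply: inj_card_eq => r r' /sN rN /sN r'N /FE/weight_latticeP.
  by rewrite !wG -eqz_mod_dvd !modz_nat eqz_nat !modn_small// => /eqP.
have <- : size s = count (fun r : nat => q r%:Z) (iota 0 N) by rewrite size_filter.
by apply: (@card_uniq_seq _ 0%N); apply: filter_uniq; exact: iota_uniq.
Qed.

End WeightLattice.

(** * Kept weights *)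

Section KeptWeights.
Variable d : nat.
Implicit Types a b : int.

(** The dimension is [d.+1], so this is the number [M = 2(2(d+1) - 1)]. *)
Definition period : nat := (d.*2.+1).*2.

Definition kept a : bool := ~~ (2 %| a)%Z || (period %| a)%Z.

Lemma kept_congr a b : (period %| a - b)%Z -> kept a = kept b.
Proof.
move=> ab; have ab2 : (2 %| a - b)%Z.
  by apply: dvdz_trans ab; rewrite dvdzE /= dvdn2 odd_double.
by rewrite /kept -(subrK b a) (dvdz_addr b ab) (dvdz_addr b ab2).
Qed.

(** Removed weights are even, so an odd step never joins two of them. *)
Lemma keptD_odd a j : kept a \/ kept (a + (j.*2.+1)%:Z).
Proof.
rewrite /kept; have [a2|_] := boolP (2 %| a)%Z; last by left.
by right; rewrite dvdz_addr// dvdzE /= dvdn2 /= odd_double.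
Qed.

Lemma count_kept k :
  count (fun r : nat => kept r%:Z) (iota 0 (k * period)) = (k * d.+1.*2)%N.
Proof.
have count_odd n : count odd (iota 0 n.*2) = n.
  elim: n => // n IH; rewrite doubleS -addn2 iotaD count_cat IH add0n /=.
  by rewrite odd_double addn0 addn1.
rewrite count_iota_periodic => [|r]; last first.
  by apply: kept_congr; rewrite PoszD addrC addKr.
(* Within a period, 0 is the only even kept residue. *)
congr muln; have := count_odd d.*2.+1; rewrite -/period.
have -> : iota 0 period = 0%N :: iota 1 period.-1 by rewrite /period doubleS.
rewrite /= add0n => count_odd1.
rewrite doubleS -count_odd1 -[RHS]add1n; congr (_ + (_ + _))%N.
apply: eq_in_count => r.
rewrite mem_iota => /andP[r0 rp]; rewrite /kept !dvdzE /= dvdn2 negbK.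
case: (odd r) => //=; apply/negbTE; apply: contraL rp => /dvdn_leq.
by move=> /(_ (ltnW r0)); rewrite /period; lia.
Qed.

Lemma count_not_kept k :
  count (fun r : nat => ~~ kept r%:Z) (iota 0 (k * period)) = (k * d.*2)%N.
Proof.
apply: (@addnI (k * d.+1.*2)%N); rewrite -{1}count_kept.
transitivity (size (iota 0 (k * period))); first exact: count_predC.
by rewrite size_iota /period; nia.
Qed.

End KeptWeights.

(** * The polyomino of kept tiles *)

Section Polyomino.
Variables (R : realType) (d k : nat).

Definition torus_size := (k.+1 * period d)%N.

Lemma torus_size_gt0 : (0 < torus_size)%N.
Proof. by rewrite muln_gt0. Qed.

Local Notation L := (weight_lattice d torus_size_gt0).
Local Notation tile := (@tile R d.+1 L).
Local Notation kept := (kept d).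

Definition kept_tiles : set (set (torus R L)) := tile @` [set n | kept (weight n)].

Lemma kept_congr_size (a b : int) : (torus_size %| a - b)%Z -> kept a = kept b.
Proof.
by move=> ab; apply: kept_congr; apply: dvdz_trans ab; rewrite dvdzE dvdn_mull.
Qed.

Definition weight_tile (a : int) := tile (a *: delta_mx 0 0).

Lemma tile_weight n : tile n = weight_tile (weight n).
Proof. by apply/tile_eq/weight_latticeP; rewrite weight_delta mulr1 subrr. Qed.

Lemma kept_weight_tile a : kept a -> kept_tiles (weight_tile a).
Proof. by move=> ka; exists (a *: delta_mx 0 0); rewrite //= weight_delta mulr1. Qed.

Lemma joined_step a j : (j <= d)%N -> kept a -> kept (a + (j.*2.+1)%:Z) ->
  rook_joined kept_tiles (weight_tile a) (weight_tile (a + (j.*2.+1)%:Z)).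
Proof.
move=> jd ka kaj; apply: rook_joined_adjacent; [exact: kept_weight_tile..|].
have -> : weight_tile (a + (j.*2.+1)%:Z) =
    tile (a *: delta_mx 0 0 + delta_mx 0 (Ordinal (jd : (j < d.+1)%N))).
  rewrite tile_weight weightD weight_delta mulr1; congr (weight_tile (_ + _)).
  by rewrite -[delta_mx _ _]scale1r weight_delta mul1r.
exact: adjacent_delta.
Qed.

(** Every kept tile is joined to the tile of weight 0: odd weights through the
    nearest multiple of the period, multiples of the period by descending one
    period in two steps of the largest size, half a period. *)
Lemma kept_rook_connected : rook_connected kept_tiles.
Proof.
have kept_mul q : kept (q * period d)%N%:Z.
  by rewrite /kept !dvdzE /= (dvdn_mull q (dvdnn _)) orbT.
have kept_odd (r : nat) : odd r -> kept r%:Z.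
  by move=> r1; rewrite /kept dvdzE /= dvdn2 r1.
have joined_mul q :
    rook_joined kept_tiles (weight_tile (q * period d)%N) (weight_tile 0).
  elim: q => [|q IH]; first by apply/rook_joined_refl/kept_weight_tile/(kept_mul 0%N).
  apply: rook_joined_trans IH.
  have kmid : kept ((q * period d)%N%:Z + (d.*2.+1)%:Z).
    rewrite -PoszD; apply: kept_odd.
    by rewrite oddD oddM /period odd_double andbF /= odd_double.
  apply: (@rook_joined_trans _ _ _ _
    (weight_tile ((q * period d)%N%:Z + (d.*2.+1)%:Z))); last first.
    by apply: rook_joined_sym; apply: joined_step => //; exact: kept_mul.
  have -> : (q.+1 * period d)%N%:Z = (q * period d)%N%:Z + (d.*2.+1)%:Z + (d.*2.+1)%:Z.
    by rewrite -!PoszD mulSn /period; congr Posz; lia.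
  apply: rook_joined_sym; apply: joined_step => //.
  by rewrite -addrA -!PoszD addnn -/(period d) addnC -mulSn; exact: kept_mul.
apply: (@rook_connected_from _ _ _ _ (weight_tile 0)) => _ [n kn <-].
have [r rE] : exists r : nat, (weight n %% torus_size)%Z = r%:Z.
  exists `|(weight n %% torus_size)%Z|%N.
  by rewrite gez0_abs// modz_ge0// eqz_nat -lt0n torus_size_gt0.
have rn : (torus_size %| r%:Z - weight n)%Z by rewrite -rE -eqz_mod_dvd modz_mod.
have -> : tile n = weight_tile r.
  apply/tile_eq/weight_latticeP; rewrite weight_delta mulr1 -opprB rpredN; exact: rn.
have kr : kept r by rewrite (kept_congr_size rn).
have := divn_eq r (period d); set q := (_ %/ _)%N; set s := (_ %% _)%N => rqs.
have [s0|s0] := eqVneq s 0%N; first by rewrite rqs s0 addn0; exact: joined_mul.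
have sp : (s < period d)%N by rewrite ltn_mod.
have s1 : odd s.
  move: kr; rewrite /kept !dvdzE /= dvdn2 negbK /dvdn -/s (negPf s0) orbF.
  by rewrite rqs oddD oddM /period odd_double andbF.
(* s is odd, so the nearest multiple of the period is one step away. *)
have [sd|sd] := leqP s d.*2.+1.
  apply: rook_joined_trans (joined_mul q); apply: rook_joined_sym.
  have rE2 : r%:Z = (q * period d)%N%:Z + (s./2.*2.+1)%:Z.
    by rewrite -PoszD {1}rqs; congr Posz; lia.
  rewrite rE2; apply: joined_step; [lia|exact: kept_mul|by rewrite -rE2].
apply: rook_joined_trans (joined_mul q.+1).
have rE2 : (q.+1 * period d)%N%:Z = r%:Z + ((period d - s)./2.*2.+1)%:Z.
  rewrite -PoszD {1}rqs mulSn; congr Posz.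
  have : odd (period d - s) by rewrite oddB ?(ltnW sp)// /period odd_double s1.
  lia.
rewrite rE2; apply: joined_step => //; last by rewrite -rE2; exact: kept_mul.
by rewrite /period in sp *; lia.
Qed.

Lemma kept_polyomino : toric_polyomino kept_tiles (\bigcup_(A in kept_tiles) A).
Proof.
split=> //; last exact: kept_rook_connected.
by move=> _ [n _ <-]; exists n.
Qed.

Lemma card_kept_tiles : kept_tiles #= `I_(k.+1 * d.+1.*2).
Proof.
rewrite -count_kept.
apply: (@card_weight_classes d torus_size torus_size_gt0 _ _ kept).
  exact: tile_eq.
exact: kept_congr_size.
Qed.

Lemma card_holes_kept :
  holes (\bigcup_(A in kept_tiles) A) #= `I_(k.+1 * d.*2).
Proof.
rewrite holes_isolated => [|m n /weight_latticeP /kept_congr_size /= <-|n j]//.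
  rewrite -count_not_kept.
  have -> : ~` [set n : 'rV[int]_d.+1 | kept (weight n)] = [set n | ~~ kept (weight n)].
    by apply/seteqP; split => n /= /negP.
  apply: (@card_weight_classes d torus_size torus_size_gt0 _ _ (fun a => ~~ kept a)).
    exact: open_tile_eq.
  by move=> a b /kept_congr_size ->.
by rewrite /= weightD -[delta_mx _ _]scale1r weight_delta mul1r; exact: keptD_odd.
Qed.

End Polyomino.

Theorem theorem1p2 (R : realType) (d : nat) (hd : (2 <= d)%N) :
  infinite_set
    [set L : lattice d |
      exists (S : set (set (torus R L))) (P : set (torus R L)) (t h : nat),
        [/\ toric_polyomino S P,
            S #= `I_t,
            t%:R = d%:R / (2 * d%:R - 1) * (covolume L)%:R :> rat,
            holes P #= `I_h &
            h%:R = (d%:R - 1) / (2 * d%:R - 1) * (covolume L)%:R :> rat]].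
Proof.
case: d hd => // d _.
apply: (@sub_infinite_set _ (range (fun k => weight_lattice d (torus_size_gt0 d k)))).
  move=> _ [k _ <-].
  exists (@kept_tiles R d k), (\bigcup_(A in @kept_tiles R d k) A).
  exists (k.+1 * d.+1.*2)%N, (k.+1 * d.*2)%N.
  have denE : 2 * d.+1%:R - 1 = (d.*2.+1)%:R :> rat.
    by rewrite -!natr1 -muln2 natrM; ring.
  have den0 : 2 * d.+1%:R - 1 != 0 :> rat by rewrite denE pnatr_eq0.
  have sizeE : (torus_size d k)%:R = k.+1%:R * (2 * (2 * d.+1%:R - 1)) :> rat.
    by rewrite denE -!natrM mul2n.
  split; [exact: kept_polyomino|exact: card_kept_tiles| |exact: card_holes_kept|].
    by rewrite covolume_weight_lattice sizeE natrM -mul2n natrM; field; rewrite nat1r.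
  rewrite covolume_weight_lattice sizeE natrM -mul2n natrM.
  have -> : d%:R = d.+1%:R - 1 :> rat by rewrite -natr1 addrK.
  by field; rewrite nat1r.
rewrite (eq_finite_set (inj_card_eq _)); first exact: infinite_nat.
move=> k l _ _ /(congr1 (@covolume d.+1)); rewrite !covolume_weight_lattice.
by move=> /eqP; rewrite eqn_pmul2r ?double_gt0// => /eqP[].
Qed.
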